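(* For every integer $k\ge1$, every graphic matroid is elementarily $(3k^3,k)$-weakly base orderable.
   Context: The graphic (cycle) matroid of a graph $G$ has ground set $E(G)$ and its bases are the edge sets of maximal spanning forests (spanning trees if $G$ is connected). An ordered pair $(B_1,B_2)$ of bases has the elementary $k$-exchange property if there exist $k$-element subsets $X\subseteq B_1\setminus B_2$, $Y\subseteq B_2\setminus B_1$ and a bijection $\varphi\colon X\to Y$ such that $(B_1\setminus Z)\cup\varphi(Z)$ is a basis for every $Z\subseteq X$. A matroid is elementarily $(\alpha,k)$-weakly base orderable if every ordered pair $(B_1,B_2)$ of bases with $|B_1\setminus B_2|\ge\alpha$ has the elementary $k$-exchange property. *)

(* Defs.v *)
From mathcomp Require Import all_boot.
Set Implicit Arguments. Unset Strict Implicit. Unset Printing Implicit Defensive.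

(* A finite (multi)graph is given by a vertex type V, an edge type E and the
   endpoint map [ends : E -> V * V] (loops and parallel edges allowed); its
   graphic (cycle) matroid has ground set E. *)

Definition joins (V E : finType) (ends : E -> V * V) (e : E) (u v : V) : bool :=
  (ends e == (u, v)) || (ends e == (v, u)).

(* F contains a cycle: n+1 >= 1 pairwise distinct edges es_0..es_n of F and
   n+1 pairwise distinct vertices vs_0..vs_n such that es_i joins vs_i and
   vs_{(i+1) mod (n+1)}.  (n = 0: a loop; n = 1: a pair of parallel edges.) *)
Definition has_cycle (V E : finType) (ends : E -> V * V) (F : {set E}) : Prop :=
  exists n (es : 'I_n.+1 -> E) (vs : 'I_n.+1 -> V),
    [/\ injective es, injective vs, (forall i, es i \in F) &
        forall i, joins ends (es i) (vs i) (vs (ordS i))].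

Definition is_forest (V E : finType) (ends : E -> V * V) (F : {set E}) : Prop :=
  ~ has_cycle ends F.

Definition is_basis (V E : finType) (ends : E -> V * V) (B : {set E}) : Prop :=
  is_forest ends B /\
  (forall F : {set E}, B \subset F -> is_forest ends F -> F = B).

Definition elem_exchange (V E : finType) (ends : E -> V * V) (k : nat)
    (B1 B2 : {set E}) : Prop :=
  exists (X Y : {set E}) (phi : E -> E),
    [/\ X \subset B1 :\: B2, Y \subset B2 :\: B1, #|X| = k & #|Y| = k] /\
    [/\ {in X &, injective phi}, phi @: X = Y &
        forall Z : {set E}, Z \subset X -> is_basis ends ((B1 :\: Z) :|: phi @: Z)].

Definition elem_wbo (V E : finType) (ends : E -> V * V) (alpha k : nat) : Prop :=
  forall B1 B2 : {set E}, is_basis ends B1 -> is_basis ends B2 ->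
    alpha <= #|B1 :\: B2| -> elem_exchange ends k B1 B2.

(* Main.v *)
Require Import Defs.
From mathcomp Require Import all_boot.

(* Root the components of the forest [B1] and let [D e] be the set of vertices
   that [e] separates from the root.  The sets [D e] are laminar, [e] is the only
   edge of [B1] crossing [D e], and so [f] can replace [e] iff [f] crosses [D e].
   If [e_1, ..., e_k] and [f_1, ..., f_k] are such that [f_i] crosses [D e_i] but
   not [D e_j] for [j > i], then all subsets of the exchanges [e_i -> f_i] can be
   carried out, one after the other.  Among [2 k^2] edges of [B1 :\: B2] there are
   [k] with pairwise disjoint [D e] or [2k] with nested [D e].  In the first case
   repeatedly take an edge of [B2] leaving the union of the remaining [D e]; in
   the second, each layer between consecutive [D e] is left by an edge of [B2]
   upwards or downwards, and [k] of these edges go in the same direction. *)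

Set Implicit Arguments. Unset Strict Implicit. Unset Printing Implicit Defensive.

Section GraphicMatroid.
Variables (V E : finType) (ends : E -> V * V).
Implicit Types (F B : {set E}) (W : {set V}) (e f g : E) (x y u v : V).

(** * Connectivity within an edge set, and cuts *)

Definition adj F : rel V := [rel u v | [exists g in F, joins ends g u v]].

Definition linked F : rel V := connect (adj F).

Definition crosses W g : bool := ((ends g).1 \in W) != ((ends g).2 \in W).

(** Forests without reference to cycles: every edge is a bridge. [forestP] proves the equivalence
    with [is_forest]. *)
Definition acyclic F : Prop :=
  forall e, e \in F -> ~~ linked (F :\ e) (ends e).1 (ends e).2.

Definition spans F : Prop := forall g, linked F (ends g).1 (ends g).2.

Lemma joins_ends g : joins ends g (ends g).1 (ends g).2.
Proof. by rewrite /joins; case: (ends g) => a b; rewrite eqxx. Qed.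

Lemma adj_ends F g : g \in F -> adj F (ends g).1 (ends g).2.
Proof. by move=> gF; apply/existsP; exists g; rewrite gF joins_ends. Qed.

Lemma adj_sym F : symmetric (adj F).
Proof.
by move=> u v; apply: eq_existsb => g; rewrite /joins orbC.
Qed.

Lemma linkedC F x y : linked F x y = linked F y x.
Proof. exact/sym_connect_sym/adj_sym. Qed.

Lemma linked_sub F F' x y : F \subset F' -> linked F x y -> linked F' x y.
Proof.
move=> sFF'; apply: connect_sub => u v /existsP[g /andP[gF jg]].
by apply/connect1/existsP; exists g; rewrite (subsetP sFF') ?jg.
Qed.

Lemma linked_sub_spans F F' x y :
    (forall g, g \in F -> linked F' (ends g).1 (ends g).2) ->
  linked F x y -> linked F' x y.
Proof.
move=> sFF'; apply: connect_sub => u v /existsP[g /andP[gF jg]].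
have := sFF' g gF.
by case/orP: jg => /eqP-> //=; rewrite linkedC.
Qed.

Lemma linked_crosses F W x y :
  linked F x y -> (x \in W) != (y \in W) -> exists2 g, g \in F & crosses W g.
Proof.
move=> lxy nW; have [/existsP[g /andP[gF cg]]|] := boolP [exists g in F, crosses W g].
  by exists g.
rewrite negb_exists => /forallP noc; case/negP: nW; apply/eqP.
apply: (@closed_connect _ (adj F) (mem W)) lxy => u v /existsP[g /andP[gF jg]].
have := noc g; rewrite gF /= negbK => /eqP.
by case/orP: jg => /eqP-> /=.
Qed.

Lemma linked_closed F g x : g \in F -> linked F x (ends g).1 = linked F x (ends g).2.
Proof.
move=> gF; apply: same_connect_r; first exact/sym_connect_sym/adj_sym.
exact/connect1/adj_ends.
Qed.

(** The [F]-components of [x] and [y] are distinct, and each contains exactly one end of [g]. *)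
Lemma linked_setU1 F g x y :
    linked (g |: F) x y -> ~~ linked F x y ->
  (linked F x (ends g).1 /\ linked F (ends g).2 y) \/
  (linked F x (ends g).2 /\ linked F (ends g).1 y).
Proof.
move=> lxy nxy.
(* An edge of [g |: F] leaving the [F]-component of [z] can only be [g]. *)
have leave z t : linked (g |: F) z t -> ~~ linked F z t ->
    linked F z (ends g).1 != linked F z (ends g).2.
  move=> lzt nzt; have [|h] := @linked_crosses _ [set w | linked F z w] _ _ lzt.
    by rewrite !inE (negbTE nzt) /linked connect0.
  rewrite !inE /crosses !inE => /orP[/eqP->//|hF] /negP[].
  exact/eqP/linked_closed.
have := leave _ _ lxy nxy.
have := leave y x; rewrite linkedC lxy linkedC nxy => /(_ isT isT).
rewrite ![linked F y _]linkedC.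
have neq w : linked F x w -> linked F w y -> False.
  by move=> lw1 lw2; case/negP: nxy; apply: connect_trans lw1 lw2.
move: (neq (ends g).1) (neq (ends g).2).
case: (linked F x _) (linked F _ y) (linked F x _) (linked F _ y)
  => [] [] [] [] //= n1 n2 _ _;
  by [left|right|case: n1|case: n2].
Qed.

Lemma acyclic_sub F F' : F \subset F' -> acyclic F' -> acyclic F.
Proof.
move=> sFF' aF' e eF; apply: contra (aF' e (subsetP sFF' e eF)).
by apply: linked_sub; apply: setSD.
Qed.

(** If an old edge [e] were no longer a bridge, its ends would be linked through [g]; going around
    that cycle the other way, through [e], links the ends of [g] inside [F]. *)
Lemma acyclic_setU1 F g :
  acyclic F -> ~~ linked F (ends g).1 (ends g).2 -> acyclic (g |: F).
Proof.
move=> aF ng e; have gF : g \notin F by apply: contra ng => /adj_ends/connect1.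
have [->|ne] := eqVneq e g; first by rewrite setU1K.
rewrite !inE (negbTE ne) /= => eF; apply/negP.
have -> : (g |: F) :\ e = g |: (F :\ e).
  apply/setP=> z; rewrite !inE.
  by case: (eqVneq z g) => [->|]; rewrite ?orbF // eq_sym ne.
move=> l; case/negP: ng.
have sub x y : linked (F :\ e) x y -> linked F x y by apply/linked_sub/subsetDl.
have le : linked F (ends e).1 (ends e).2 by apply/connect1/adj_ends.
have [[/sub l1 /sub l2]|[/sub l1 /sub l2]] := linked_setU1 l (aF e eF).
  rewrite linkedC in l1; rewrite linkedC in l2.
  exact: connect_trans l1 (connect_trans le l2).
rewrite linkedC in le; exact: connect_trans l2 (connect_trans le l1).
Qed.

(** * Cycles, forests and bases *)

Lemma has_cycle_linked F :
  has_cycle ends F -> exists2 e, e \in F & linked (F :\ e) (ends e).1 (ends e).2.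
Proof.
case=> n [es [vs [ies ivs esF esj]]]; exists (es ord_max) => //.
(* The walk from [vs ord0] along the cycle avoids the last edge, whose ends it therefore links. *)
have walk i : i <= n -> linked (F :\ es ord_max) (vs ord0) (vs (inord i)).
  elim: i => [|i IHi] lin.
    by rewrite (_ : inord 0 = ord0) ?/linked ?connect0 //; apply/val_inj; rewrite /= inordK.
  have iK : (inord i : 'I_n.+1) = i :> nat by rewrite inordK // ltnS ltnW.
  apply: connect_trans (IHi (ltnW lin)) _; apply/connect1/existsP; exists (es (inord i)).
  rewrite !inE esF andbT (inj_eq ies) -val_eqE /= iK neq_ltn lin /=.
  have -> : inord i.+1 = ordS (inord i : 'I_n.+1).
    by apply/val_inj; rewrite /= iK inordK ?modn_small.
  exact: esj.
have := walk n (leqnn n); rewrite (_ : inord n = ord_max); last first.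
  by apply/val_inj; rewrite /= inordK.
have := esj ord_max; rewrite (_ : ordS ord_max = ord0); last first.
  by apply/val_inj; rewrite /= modnn.
by case/orP=> /eqP-> //=; rewrite linkedC.
Qed.

Lemma linked_has_cycle F e :
  e \in F -> linked (F :\ e) (ends e).1 (ends e).2 -> has_cycle ends F.
Proof.
move=> eF /connectP[p0 pth0 lst0].
case/shortenP: pth0 lst0 => p pth uq _ lst {p0}.
set x := (ends e).1 in pth uq lst.
pose vs (i : nat) := nth x (x :: p) i.
(* The default [e] is never taken along the path, by [edP]. *)
pose ed u v := odflt e [pick g in F :\ e | joins ends g u v].
have edP i : i < size p -> ed (vs i) (vs i.+1) \in F :\ e /\
    joins ends (ed (vs i) (vs i.+1)) (vs i) (vs i.+1).
  move=> ip; have /existsP[g /andP[gF jg]] := pathP x pth i ip.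
  rewrite /ed; case: pickP => [h /andP[] //|/(_ g)] /=.
  by rewrite [joins _ _ _ _]jg gF.
pose es (i : nat) := if i < size p then ed (vs i) (vs i.+1) else e.
have vs_inj i j : i <= size p -> j <= size p -> vs i = vs j -> i = j.
  by move=> li lj /eqP; rewrite nth_uniq // => /eqP.
exists (size p), (fun i => es i), (fun i => vs i); split.
- have wlt i j : i < size p -> j < size p -> es i = es j -> i = j.
    move=> li lj; rewrite /es li lj => eq_ed.
    have [_ ji] := edP i li; have [_ jj] := edP j lj; rewrite eq_ed in ji.
    have [ii1 ij1] : i <= size p /\ j <= size p by split; apply: ltnW.
    (* Equal edges have equal ends. With the same orientation the indices agree; with opposite ones,
       [i = j.+1] and [j = i.+1], which is absurd. *)
    case/orP: ji => /eqP Ei; case/orP: jj => /eqP; rewrite Ei => -[E1 E2].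
    + exact: vs_inj.
    + have {}E1 := vs_inj _ _ ii1 lj E1; have {}E2 := vs_inj _ _ li ij1 E2.
      by suff: i < j by [rewrite E1 ltnNge leqnSn]; rewrite -E2.
    + have {}E1 := vs_inj _ _ li ij1 E1; have {}E2 := vs_inj _ _ ii1 lj E2.
      by suff: i < j by [rewrite E2 ltnNge leqnSn]; rewrite -E1.
    + exact: vs_inj.
  have neq i : i < size p -> es i <> e.
    by move=> li eie; have [] := edP i li; rewrite /es li in eie; rewrite eie !inE eqxx.
  have last_ord (i : 'I_(size p).+1) : ~~ (i < size p) -> i = size p :> nat.
    by rewrite -leqNgt => li; apply/eqP; rewrite eqn_leq li -ltnS ltn_ord.
  move=> i j eij; apply/val_inj => /=.
  have [li|li] := boolP (i < size p); have [lj|lj] := boolP (j < size p).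
  + exact: wlt.
  + by case: (neq i li); rewrite eij /es (negbTE lj).
  + by case: (neq j lj); rewrite -eij /es (negbTE li).
  + exact: etrans (last_ord i li) (esym (last_ord j lj)).
- by move=> i j /vs_inj eij; apply/val_inj/eij; rewrite -ltnS ltn_ord.
- move=> i; rewrite /es; case: ifP => // li; have [] := edP i li.
  by rewrite !inE => /andP[].
- move=> i; rewrite /es /=; case: ifP => li.
    by rewrite modn_small ?ltnS //; have [] := edP i li.
  have -> : i = size p :> nat.
    by apply/eqP; rewrite eqn_leq -ltnS ltn_ord /= leqNgt li.
  by rewrite modnn /vs nth_last /= -lst /joins /x; case: (ends e) => a b; rewrite eqxx orbT.
Qed.

Lemma forestP F : is_forest ends F <-> acyclic F.
Proof.
split=> [nF e eF | aF /has_cycle_linked[e eF]]; last exact/negP/aF.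
by apply/negP=> /(linked_has_cycle eF).
Qed.

Lemma basisP B : is_basis ends B <-> acyclic B /\ spans B.
Proof.
split=> [[/forestP aB maxB] | [aB sB]].
  split=> // g; apply/negPn/negP => ng.
  have eqB := maxB _ (subsetUr [set g] B) (proj2 (forestP _) (acyclic_setU1 aB ng)).
  by case/negP: ng; apply/connect1/adj_ends; rewrite -eqB !inE eqxx.
split=> [|F sBF /forestP aF]; first exact/forestP.
apply/eqP; rewrite eqEsubset sBF andbT; apply/subsetP => g gF.
apply/negPn/negP => gB; case/negP: (aF g gF).
by apply: linked_sub (sB g); rewrite subsetD1 sBF.
Qed.

(** No edge of [B :\ e] crosses [W], so [f] joins two of its components and closes no cycle. Since
    [B] links the ends of [f] only through [e], the ends of [e] are now linked through [f]. *)
Lemma basis_exchange B e f W :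
    is_basis ends B -> (forall g, g \in B -> crosses W g -> g = e) -> crosses W f ->
  is_basis ends (f |: (B :\ e)).
Proof.
move=> /basisP[aB sB] onlye cf; apply/basisP.
have nf : ~~ linked (B :\ e) (ends f).1 (ends f).2.
  apply/negP=> /linked_crosses/(_ cf)[g].
  by rewrite !inE => /andP[/eqP ne gB] cg; apply/ne/onlye.
split; first by apply: acyclic_setU1 nf; apply: acyclic_sub aB; apply: subsetDl.
have lf : linked (f |: (B :\ e)) (ends f).1 (ends f).2.
  by apply/connect1/adj_ends; rewrite !inE eqxx.
have sub x y : linked (B :\ e) x y -> linked (f |: (B :\ e)) x y.
  exact/linked_sub/subsetUr.
move=> g; apply: linked_sub_spans (sB g) => h hB.
have [->|ne] := eqVneq h e; last first.
  by apply/connect1/adj_ends; rewrite !inE ne hB orbT.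
have lB : linked (e |: (B :\ e)) (ends f).1 (ends f).2.
  by apply: linked_sub (sB f); apply/subsetP=> z zB; rewrite !inE zB andbT orbN.
have [[/sub l1 /sub l2]|[/sub l1 /sub l2]] := linked_setU1 lB nf.
  rewrite linkedC in l1; rewrite linkedC in l2.
  exact: connect_trans l1 (connect_trans lf l2).
rewrite linkedC in lf; exact: connect_trans l2 (connect_trans lf l1).
Qed.

(** * Shores: the laminar cuts of a rooted forest *)

Definition comp_root F x : V := root (adj F) x.

(* The side of the cut of the forest [F] at [e] that avoids the root of the
   component of [e]. *)
Definition shore F e : {set V} :=
  [set y | linked F (ends e).1 y && ~~ linked (F :\ e) (comp_root F (ends e).1) y].

Lemma crosses_shore_eq F e g : g \in F -> crosses (shore F e) g -> g = e.
Proof.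
move=> gF; rewrite /crosses !inE (linked_closed _ gF).
by have [//|ne] := eqVneq g e; rewrite (@linked_closed (F :\ e) g) ?eqxx // !inE ne.
Qed.

Section Shores.
Variable F : {set E}.
Hypothesis acyclicF : acyclic F.

Lemma linked_setD1 e x y :
    e \in F -> linked F x y ->
  [\/ linked (F :\ e) x y,
      linked (F :\ e) x (ends e).1 /\ linked (F :\ e) (ends e).2 y |
      linked (F :\ e) x (ends e).2 /\ linked (F :\ e) (ends e).1 y].
Proof.
move=> eF lxy; have [|nxy] := boolP (linked (F :\ e) x y); first by constructor 1.
rewrite -(setD1K eF) in lxy.
by have [|] := linked_setU1 lxy nxy; [constructor 2|constructor 3].
Qed.

(** After deleting [e], the root stays linked to one end of [e], and by acyclicity not to the
    other. *)
Lemma crosses_shore e : e \in F -> crosses (shore F e) e.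
Proof.
move=> eF; rewrite /crosses !inE -(linked_closed _ eF) /linked connect0 /= -/(linked _).
set r := comp_root F _.
have lr : linked F r (ends e).1 by rewrite linkedC; apply: connect_root.
have := acyclicF eF; have [l|l1|l1] := linked_setD1 eF lr.
- move=> n; rewrite l; apply: contra n => /eqP; rewrite /= => /esym/negbFE.
  by apply: connect_trans; rewrite -/(linked _ _ _) linkedC.
- case: l1 => l1 _ n; rewrite l1; apply: contra n => /eqP; rewrite /= => /esym/negbFE.
  by apply: connect_trans; rewrite -/(linked _ _ _) linkedC.
case: l1 => l1 _ n; rewrite l1; apply: contra n => /eqP; rewrite /= => /negbFE l2.
by apply: connect_trans l1; rewrite -/(linked _ _ _) linkedC.
Qed.

Lemma shore_inj : {in F &, injective (shore F)}.
Proof.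
move=> e e' eF e'F eq_s; apply: (crosses_shore_eq eF).
by rewrite -eq_s; apply: crosses_shore.
Qed.

(** Links from the root to [x] and to [y] must both use [e], and in the same direction; hence both
    points hang on the same end of [e]. *)
Lemma shore_linked e x y :
  e \in F -> x \in shore F e -> y \in shore F e -> linked (F :\ e) x y.
Proof.
move=> eF; rewrite !inE; set r := comp_root F _ => /andP[lx nx] /andP[ly ny].
have lr z : linked F (ends e).1 z -> linked F r z.
  by apply: connect_trans; rewrite -/(linked _ _ _) linkedC; apply: connect_root.
have [l|[a1 a2]|[a1 a2]] := linked_setD1 eF (lr x lx); first by rewrite l in nx.
  have [l|[b1 b2]|[b1 b2]] := linked_setD1 eF (lr y ly); first by rewrite l in ny.
    by rewrite linkedC in a2; apply: connect_trans a2 b2.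
  by case/negP: ny; apply: connect_trans a1 b2.
have [l|[b1 b2]|[b1 b2]] := linked_setD1 eF (lr y ly); first by rewrite l in ny.
  by case/negP: nx; apply: connect_trans b1 a2.
by rewrite linkedC in a2; apply: connect_trans a2 b2.
Qed.

(* A path inside [shore F e] leaving [shore F e'] must run through [e']. *)
Lemma shore_swallow e e' x y :
    e \in F -> e' \in F -> x \in shore F e -> y \in shore F e ->
    x \in shore F e' -> y \notin shore F e' ->
  (ends e').1 \in shore F e /\ (ends e').2 \in shore F e.
Proof.
move=> eF e'F xe ye xe' ye'; have lxy := shore_linked eF xe ye.
have [|g gF] := @linked_crosses _ (shore F e' :&: shore F e) _ _ lxy.
  by rewrite !in_setI xe xe' (negbTE ye').
have gF' : g \in F by move: gF; rewrite !inE => /andP[].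
have ng : ~~ crosses (shore F e) g.
  by apply/negP => /(crosses_shore_eq gF') eg; move: gF; rewrite eg !inE eqxx.
move: ng; rewrite negbK => /eqP ng; rewrite /crosses !in_setI -ng => cg.
have gs : (ends g).1 \in shore F e by apply: contraR cg => /negbTE->; rewrite !andbF.
rewrite gs !andbT in cg; have eg := crosses_shore_eq gF' cg.
by rewrite -eg -ng.
Qed.

(** If two shores overlapped properly, each would contain both ends of the other's edge, so no edge
    of [F] would cross their union. But the common root lies outside the union and is linked to a
    point inside. *)
Lemma shore_laminar e e' :
    e \in F -> e' \in F ->
  [|| shore F e \subset shore F e', shore F e' \subset shore F e |
      [disjoint shore F e & shore F e']].
Proof.
move=> eF e'F; apply/negPn/negP; rewrite !negb_or.
case/and3P=> [/subsetPn[y ye ye'] /subsetPn[z ze' ze]].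
rewrite -setI_eq0 => /set0Pn[x /setIP[xe xe']].
have [a1 a2] := shore_swallow eF e'F xe ye xe' ye'.
have [b1 b2] := shore_swallow e'F eF xe' ze' xe ze.
pose W := shore F e :|: shore F e'.
pose r := comp_root F (ends e).1.
have lx : linked F (ends e).1 x by move: xe; rewrite inE => /andP[].
have lx' : linked F (ends e').1 x by move: xe'; rewrite inE => /andP[].
have lr : linked F r (ends e).1 by rewrite linkedC; apply: connect_root.
have rE : r = comp_root F (ends e').1.
  apply/rootP; first exact/sym_connect_sym/adj_sym.
  by apply: connect_trans lx _; rewrite -/(linked _ _ _) linkedC.
have nr : r \notin W.
  by rewrite !inE negb_or !negb_and !negbK -rE /linked !connect0 !orbT.
have [|g gF] := @linked_crosses _ W _ _ (connect_trans lr lx).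
  by rewrite (negbTE nr) in_setU xe.
rewrite /crosses !in_setU => cg.
have [ge|ge] : crosses (shore F e) g \/ crosses (shore F e') g.
- apply/orP; move: cg; rewrite /crosses.
  by do 4!case: (_ \in _).
- by move: cg; rewrite (crosses_shore_eq gF ge) b1 b2 !orbT.
by move: cg; rewrite (crosses_shore_eq gF ge) a1 a2.
Qed.

End Shores.

(** * Simultaneous exchanges in elimination order *)

Section Elimination.
Variables (B2 : {set E}) (D : E -> {set V}).

(** Quantifying over all nonempty subsets encodes the elimination order without listing it, and
    makes the notion hereditary. *)
Definition eliminable (A : {set E}) : Prop :=
  forall A' : {set E}, A' \subset A -> A' != set0 ->
  exists e f, [/\ e \in A', f \in B2, crosses (D e) f &
    forall e', e' \in A' -> e' != e -> ~~ crosses (D e') f].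

(* The elimination order makes the exchange matrix triangular: once the first
   [e] has been replaced by [phi e], each remaining [e'] is still the only edge
   of the new basis crossing [D e']. *)
Lemma eliminable_exchange (A : {set E}) : eliminable A ->
  exists phi : E -> E, [/\ {in A &, injective phi},
    forall e, e \in A -> phi e \in B2 /\ crosses (D e) (phi e) &
    forall B (Z : {set E}), is_basis ends B -> Z \subset A ->
      (forall e, e \in A -> crosses (D e) e) ->
      (forall e g, e \in A -> g \in B -> crosses (D e) g -> g = e) ->
      is_basis ends ((B :\: Z) :|: phi @: Z)].
Proof.
have [n] := ubnP #|A|; elim: n A => // n IHn A; rewrite ltnS => leAn elA.
have [->|A0] := eqVneq A set0.
  exists id; split=> [e ? _|e|B Z bB]; rewrite ?inE // subset0 => /eqP-> _ _.
  by rewrite setD0 imset0 setU0.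
have [e [f [eA fB2 cef nf]]] := elA A (subxx A) A0.
have [||phi [phi_inj phiP phi_ex]] := IHn (A :\ e).
- by apply: leq_trans leAn; rewrite [ltnRHS](cardsD1 e) eA.
- by move=> A' sA'; apply: elA; apply: subset_trans sA' (subsetDl _ _).
pose psi (d : E) := if d == e then f else phi d.
have psi_e : psi e = f by rewrite /psi eqxx.
have psi_ne (x : E) : x != e -> psi x = phi x by rewrite /psi => /negbTE->.
(* [phi x] crosses [D x], whereas [f] crosses no remaining shore. *)
have phi_nf (x : E) : x \in A -> x != e -> phi x != f.
  move=> xA ne; apply: contraNneq (nf x xA ne) => <-.
  have /phiP[_] // : x \in A :\ e; by rewrite !inE ne.
exists psi; split.
- move=> x y xA yA; have [->|nx] := eqVneq x e; have [->|ny] := eqVneq y e => //.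
  + by rewrite psi_e psi_ne // => /esym/eqP; rewrite (negbTE (phi_nf _ _ _)).
  + by rewrite psi_e psi_ne // => /eqP; rewrite (negbTE (phi_nf _ _ _)).
  by rewrite !psi_ne //; apply: phi_inj; rewrite !inE ?nx ?ny.
- move=> x xA; have [->|nx] := eqVneq x e; first by rewrite psi_e.
  by rewrite psi_ne //; apply: phiP; rewrite !inE nx.
move=> B Z bB sZA cA oA.
have psi_im (Y : {set E}) : e \notin Y -> psi @: Y = phi @: Y.
  move=> eY; apply: eq_in_imset => x xY.
  by rewrite psi_ne //; apply: contraNneq eY => <-.
have sDA : A :\ e \subset A by apply: subsetDl.
have [eZ|eZ] := boolP (e \in Z); last first.
  rewrite psi_im //; apply: phi_ex => //; first by rewrite subsetD1 sZA.
  - by move=> x /(subsetP sDA); apply: cA.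
  by move=> x g /(subsetP sDA); apply: oA.
(* The exchange at [e] comes first; the induction hypothesis then handles [Z :\ e] in the new
   basis. *)
have bB' := basis_exchange bB (fun g => oA e g eA) cef.
have := phi_ex _ (Z :\ e) bB'; rewrite -psi_im; last by rewrite !inE eqxx.
move=> /(_ (setSD _ sZA)) basis'.
have -> : (B :\: Z) :|: psi @: Z = ((f |: B :\ e) :\: (Z :\ e)) :|: psi @: (Z :\ e).
  rewrite -{2}(setD1K eZ) imsetU1 psi_e.
  (* Otherwise [f] would cross its own [D f], contrary to the choice of [f]. So later removals leave
     [f] in place. *)
  have fZ : f \notin Z :\ e.
    rewrite !inE; apply/negP => /andP[ne /(subsetP sZA) fA].
    by have := nf f fA ne; rewrite cA.
  apply/setP => g; rewrite !in_setU !in_setD !in_setU1 !in_setD1 !in_set1.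
  case: (g \in psi @: _); rewrite ?orbT ?orbF //.
  have [->|ng] := eqVneq g f; first by rewrite orbT; move: fZ; rewrite !inE => ->.
  by have [->|] := eqVneq g e; rewrite ?eZ ?andbF ?orbF.
apply: basis'.
- by move=> x /(subsetP sDA); apply: cA.
move=> x g; rewrite !inE => /andP[nx xA] /orP[/eqP->|/andP[_ gB]]; last exact: oA.
by rewrite (negbTE (nf x xA nx)).
Qed.

Lemma eliminable_sub (A A' : {set E}) : A' \subset A -> eliminable A -> eliminable A'.
Proof. by move=> sA'A elA A'' sA''; apply: elA; apply: subset_trans sA'A. Qed.

(** In any nonempty subset, an element of largest key can be eliminated first. *)
Lemma eliminable_by_key (h : E -> nat) (A : {set E}) :
    {in A &, injective h} ->
    (forall e, e \in A -> exists f, [/\ f \in B2, crosses (D e) f &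
       forall e', e' \in A -> h e' < h e -> ~~ crosses (D e') f]) ->
  eliminable A.
Proof.
move=> h_inj hA A' sA'A /set0Pn[e0 e0A'].
case: (@arg_maxnP _ e0 (mem A') h e0A') => e eA' maxe.
have [f [fB2 cf nf]] := hA e (subsetP sA'A e eA'); exists e, f; split=> // e' e'A' ne.
have [eA e'A] := (subsetP sA'A e eA', subsetP sA'A e' e'A').
apply: nf => //; rewrite ltn_neqAle [_ <= _]maxe // andbT.
by apply: contra ne => /eqP/(h_inj _ _ e'A eA)->.
Qed.

End Elimination.

(** Orients [g] out of [W]; the last clause allows testing every other cut on the same [a] and
    [b]. *)
Lemma crossesP W g : crosses W g ->
  exists a b, [/\ a \in W, b \notin W &
    forall W', crosses W' g = ((a \in W') != (b \in W'))].
Proof.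
rewrite /crosses; case: (ends g) => a b /=; have [aW|aW] := boolP (a \in W) => bW.
  by exists a, b; split=> //; case: (b \in W) bW.
by exists b, a; split=> // [|W']; [case: (b \in W) bW | rewrite eq_sym].
Qed.

(** * Antichains and chains of shores for two bases *)

Section TwoBases.
Variables B1 B2 : {set E}.
Hypotheses (basis1 : is_basis ends B1) (basis2 : is_basis ends B2).

Let D := shore B1.
Let acyclic1 : acyclic B1. Proof. by case/basisP: basis1. Qed.

Lemma basis_crosses W e : crosses W e -> exists2 f, f \in B2 & crosses W f.
Proof. by case/basisP: basis2 => _ /(_ e); apply: linked_crosses. Qed.

Lemma antichain_eliminable (A : {set E}) :
    A \subset B1 -> {in A &, forall e e', e != e' -> [disjoint D e & D e']} ->
  eliminable B2 D A.
Proof.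
move=> sAB disA A' sA'A /set0Pn[e0 e0A']; pose W := \bigcup_(e in A') D e.
have e0A := subsetP sA'A e0 e0A'.
have : crosses W e0.
  have [a [b [aD bD cE]]] := crossesP (crosses_shore acyclic1 (subsetP sAB _ e0A)).
  rewrite cE (_ : a \in W); last by apply/bigcupP; exists e0.
  (* If the outer end [b] of [e0] lay in another shore [D e], then [e0] would cross [D e], forcing
     [e0 = e]. *)
  suff /negbTE-> : b \notin W by [].
  apply/bigcupP => -[e eA' be]; have eA := subsetP sA'A e eA'.
  have [ee0|ne] := eqVneq e e0; first by rewrite ee0 in be; case/negP: bD.
  have ae : a \in D e = false by apply: disjointFl (disA e e0 eA e0A ne) aD.
  case/eqP: ne; apply/esym/(crosses_shore_eq (subsetP sAB _ e0A)).
  by rewrite cE be ae.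
case/basis_crosses=> f fB2 /crossesP[a [b [/bigcupP[e eA' ae] bW cE]]].
have nb (x : E) : x \in A' -> b \in D x = false.
  by move=> xA'; apply: contraNF bW => bx; apply/bigcupP; exists x.
exists e, f; split; rewrite ?cE ?ae ?nb // => e' e'A' ne.
have [eA e'A] := (subsetP sA'A e eA', subsetP sA'A e' e'A').
by rewrite cE nb // (disjointFl (disA e' e e'A eA ne) ae).
Qed.

(* Along a chain, a [B2]-edge leaving the layer between [D e] and the next
   smaller shore [D p] either leaves [D e] upwards or enters [D p] downwards;
   accordingly it crosses no shore below [D e], or none above [D p]. *)
Lemma chain_eliminable (A : {set E}) :
    A \subset B1 -> {in A &, forall e e', (D e \subset D e') || (D e' \subset D e)} ->
  exists U L : {set E}, [/\ U \subset A, L \subset A, #|A| <= #|U| + #|L|,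
    eliminable B2 D U & eliminable B2 D L].
Proof.
move=> sAB chA; pose n e := #|D e|.
have le_sub e e' : e \in A -> e' \in A -> n e <= n e' -> D e \subset D e'.
  move=> eA e'A le; case/orP: (chA e e' eA e'A) => // s'.
  by rewrite (_ : D e' = D e) //; apply/eqP; rewrite eqEcard s'.
have n_inj : {in A &, injective n}.
  move=> e e' eA e'A enn; have [eB e'B] := (subsetP sAB _ eA, subsetP sAB _ e'A).
  apply: (shore_inj acyclic1 eB e'B); apply/eqP.
  by rewrite eqEsubset !le_sub ?enn.
pose up e f := [forall e' in A, (n e' < n e) ==> ~~ crosses (D e') f].
pose dn e f := [forall e' in A, (n e < n e') ==> ~~ crosses (D e') f].
pose U := [set e in A | [exists f in B2, crosses (D e) f && up e f]].
pose L := [set e in A | [exists f in B2, crosses (D e) f && dn e f]].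
have sUA : U \subset A by apply/subsetP=> e; rewrite inE => /andP[].
have sLA : L \subset A by apply/subsetP=> e; rewrite inE => /andP[].
pose below e := [set x in A | n x < n e].
(* The next smaller shore of the chain. The default matters only when nothing lies below [e], which
   [predP] excludes outside [U]. *)
pose pred e := odflt e [pick p in below e | [forall x in below e, n x <= n p]].
have predP e : e \in A :\: U ->
    [/\ pred e \in below e, forall x : E, x \in below e -> n x <= n (pred e) & pred e \in L].
  rewrite inE => /andP[eU eA]; have eB := subsetP sAB e eA.
  have ce := crosses_shore acyclic1 eB.
  have nU f : f \in B2 -> crosses (D e) f -> ~ up e f.
    move=> fB2 cf uf; case/negP: eU; rewrite inE eA; apply/existsP; exists f.
    by rewrite fB2 cf.
  (* The smallest shore of the chain always belongs to [U], since [up] is then vacuous. *)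
  have [b0|/set0Pn[x0 x0b]] := eqVneq (below e) set0.
    have [f fB2 cf] := basis_crosses ce; case: (nU f fB2 cf).
    apply/forallP=> x; apply/implyP=> xA; apply/implyP=> xe.
    by have := in_set0 x; rewrite -b0 inE xA xe.
  have : pred e \in below e /\ forall x : E, x \in below e -> n x <= n (pred e).
    rewrite /pred; case: pickP => [p /andP[pb /forallP maxp]|none].
      by split=> // x xb; have := maxp x; rewrite xb.
    case: (@arg_maxnP _ x0 (mem (below e)) n x0b) => p pb maxp.
    case/negP: (none p); apply/andP; split=> //.
    by apply/forallP=> x; apply/implyP=> xb; apply: maxp.
  move: (pred e) => p [pb maxp]; split=> //.
  have [pA pe] : p \in A /\ n p < n e by move: pb; rewrite inE => /andP[].
  have sDp : D p \subset D e by apply: le_sub => //; apply: ltnW.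
  (* The inner end of [e] is not in [D p]: otherwise [e] would cross [D p] and equal [p]. Thus [e],
     and hence some edge of [B2], leaves the layer. *)
  have : crosses (D e :\: D p) e.
    have [a [b [ae be cE]]] := crossesP ce.
    rewrite cE !in_setD ae (negbTE be) andbF andbT; case: (boolP (a \in D p)) => // ap.
    have := @crosses_shore_eq B1 p e eB; rewrite -/D cE ap (contraNF (subsetP sDp b) be).
    by move=> /(_ isT) ep; rewrite ep ltnn in pe.
  case/basis_crosses=> f fB2 /crossesP[a [b []]].
  rewrite !in_setD => /andP[ap ae] nb cE; have [be|be] := boolP (b \in D e); last first.
    case: (nU f fB2); first by rewrite cE ae (negbTE be).
    apply/forallP=> x; apply/implyP=> xA; apply/implyP=> xe.
    have sxp : D x \subset D p by apply: le_sub => //; apply: maxp; rewrite inE xA.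
    rewrite cE (contraNF (subsetP sxp a) ap).
    by rewrite (contraNF (subsetP (subset_trans sxp sDp) b) be).
  rewrite be andbT negbK in nb.
  rewrite inE pA; apply/existsP; exists f; rewrite fB2 cE nb (negbTE ap) /=.
  apply/forallP=> x; apply/implyP=> xA; apply/implyP=> px.
  have sex : D e \subset D x.
    apply: le_sub => //; rewrite leqNgt; apply/negP=> xe.
    by have := maxp x; rewrite inE xA xe leqNgt px => /(_ isT).
  by rewrite cE !(subsetP sex).
(* [pred] is strictly increasing on [A :\: U], so it injects this set into [L]; this gives the
   cardinality bound. *)
have pred_lt e e' : e \in A :\: U -> e' \in A :\: U -> n e < n e' -> n (pred e) < n (pred e').
  move=> eAU e'AU lt; have [pb _ _] := predP e eAU; have [_ mx _] := predP e' e'AU.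
  have eA : e \in A by move: eAU; rewrite inE => /andP[].
  by move: pb; rewrite inE => /andP[_ /leq_trans]; apply; apply: mx; rewrite inE eA.
have pred_inj : {in A :\: U &, injective pred}.
  move=> e e' eAU e'AU epp.
  have [eA e'A] : e \in A /\ e' \in A by move: eAU e'AU; rewrite !inE => /andP[_ ->] /andP[].
  apply: n_inj => //; case: (ltngtP (n e) (n e')) => // lt.
    by have := pred_lt _ _ eAU e'AU lt; rewrite epp ltnn.
  by have := pred_lt _ _ e'AU eAU lt; rewrite epp ltnn.
exists U, L; split=> //.
- rewrite -(cardsID U A) (setIidPr sUA) leq_add2l -(card_in_imset pred_inj).
  by apply/subset_leq_card/subsetP=> _ /imsetP[e eAU ->]; case: (predP e eAU).
- apply: (@eliminable_by_key _ _ n).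
    by move=> e e' /(subsetP sUA) eA /(subsetP sUA) e'A; apply: n_inj.
  move=> e; rewrite inE => /andP[eA /existsP[f /and3P[fB2 cf /forallP uf]]].
  exists f; split=> // e' e'U lt; have := uf e'.
  by rewrite (subsetP sUA) // lt.
(* For [L] the smallest shores are eliminated first, so the key is the size of the complement. *)
have lt_compl e e' : (#|~: D e| < #|~: D e'|) = (n e' < n e).
  by rewrite -(ltn_add2l #|D e|) cardsC -(cardsC (D e')) ltn_add2r.
apply: (@eliminable_by_key _ _ (fun e => #|~: D e|)).
  move=> e e' /(subsetP sLA) eA /(subsetP sLA) e'A enn; apply: n_inj => //.
  by case: (ltngtP (n e) (n e')) => //; rewrite -lt_compl enn ltnn.
move=> e; rewrite inE => /andP[eA /existsP[f /and3P[fB2 cf /forallP df]]].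
exists f; split=> // e' e'L; rewrite lt_compl => lt; have := df e'.
by rewrite (subsetP sLA) // lt.
Qed.

Lemma eliminable_elem_exchange (A : {set E}) k :
    A \subset B1 :\: B2 -> k <= #|A| -> eliminable B2 D A ->
  elem_exchange ends k B1 B2.
Proof.
move=> sAS /card_geqP[s [us szs sA]] elA; pose X := [set x in s].
have sXA : X \subset A by apply/subsetP=> x; rewrite inE; apply: sA.
have cX : #|X| = k by rewrite cardsE (card_uniqP us).
have [phi [phi_inj phiP phi_ex]] := eliminable_exchange (eliminable_sub sXA elA).
have X1 e : e \in X -> e \in B1 /\ e \notin B2.
  by move=> /(subsetP sXA)/(subsetP sAS); rewrite inE => /andP[].
exists X, (phi @: X), phi; split; split=> //.
- exact: subset_trans sAS.
(* If [phi e] were in [B1], crossing [D e] would make it equal to [e], which is not in [B2]. *)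
- apply/subsetP=> _ /imsetP[e eX ->]; have [pB2 cp] := phiP e eX; rewrite inE pB2 andbT.
  apply/negP=> pB1; have [_ /negP[]] := X1 e eX.
  by rewrite -(crosses_shore_eq pB1 cp).
- by rewrite card_in_imset.
move=> Z sZX; apply: phi_ex => // [e /X1[eB _]|e g _].
  exact: crosses_shore.
exact: crosses_shore_eq.
Qed.

(** The number of shores containing [D e] serves as a height: a large height yields a chain, and
    otherwise fewer than [k.*2] heights force [k] edges of equal height, whose shores form an
    antichain. *)
Lemma elem_exchange_of_large_diff k :
  k.*2 * k <= #|B1 :\: B2| -> 0 < k -> elem_exchange ends k B1 B2.
Proof.
move=> cS k0; have [S [cardS sSD sSB]] : exists S : {set E},
    [/\ k.*2 * k <= #|S|, S \subset B1 :\: B2 & S \subset B1].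
  by exists (B1 :\: B2); split; rewrite ?subsetDl.
pose above e := [set e' in S | D e \subset D e'].
have [/existsP[e /andP[eS he]]|] := boolP [exists e in S, k.*2 <= #|above e|].
  have sAS : above e \subset S by apply/subsetP=> x; rewrite inE => /andP[].
  have [a [b [ae _ _]]] := crossesP (crosses_shore acyclic1 (subsetP sSB e eS)).
  have [||U [L [sU sL cUL elU elL]]] := @chain_eliminable (above e).
  - exact: subset_trans sSB.
  - move=> x y; rewrite !inE => /andP[/(subsetP sSB) xB ex] /andP[/(subsetP sSB) yB ey].
    (* Shores above [D e] share the point [a], so laminarity makes them comparable. *)
    case/or3P: (shore_laminar xB yB) => [->//|->|dis]; first by rewrite orbT.
    by have := disjointFr dis (subsetP ex a ae); rewrite (subsetP ey a ae).
  have [kU|Uk] := leqP k #|U|.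
    by apply: eliminable_elem_exchange (subset_trans (subset_trans sU sAS) sSD) kU elU.
  apply: eliminable_elem_exchange (subset_trans (subset_trans sL sAS) sSD) _ elL.
  have := leq_trans he cUL; rewrite -addnn leqNgt => /negP nlt.
  rewrite leqNgt; apply/negP => Lk; apply: nlt.
  by apply: leq_trans (leq_add Uk (ltnW Lk)); rewrite addSn.
rewrite negb_exists => /forallP short.
pose level (i : nat) := [set e in S | #|above e| == i].
have [i ki] : exists i, k <= #|level i|.
  have [/existsP[i ki]|] := boolP [exists i : 'I_k.*2, k <= #|level i|]; first by exists i.
  rewrite negb_exists => /forallP small; move: cardS; rewrite leqNgt => /negP[].
  have lt_h e : e \in S -> #|above e| < k.*2.
    by move=> eS; have := short e; rewrite eS /= -ltnNge.
  have -> : #|S| = \sum_(i < k.*2) #|level i|.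
    have k2 : 0 < k.*2 by rewrite double_gt0.
    rewrite -sum1_card (partition_big (fun e => insubd (Ordinal k2) #|above e|) predT) //=.
    apply: eq_bigr => i _; rewrite -sum1_card; apply: eq_bigl => e; rewrite inE.
    by case: (boolP (e \in S)) => //= eS; rewrite -val_eqE val_insubd lt_h.
  (* Levels of size at most [k.-1] would sum to at most [k.*2 * k.-1], less than [k.*2 * k]. *)
  apply: leq_ltn_trans (_ : \sum_(i < k.*2) k.-1 < _).
    by apply: leq_sum => i _; rewrite -ltnS (prednK k0) ltnNge.
  by rewrite sum_nat_const card_ord ltn_pmul2l ?double_gt0 // prednK.
have sLS : level i \subset S by apply/subsetP=> e; rewrite inE => /andP[].
apply: eliminable_elem_exchange (subset_trans sLS sSD) ki (antichain_eliminable (subset_trans sLS sSB) _).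
(* Passing to a strictly larger shore strictly decreases the height, since [e] itself drops out of
   [above]. *)
have incomp e e' : e \in level i -> e' \in level i -> e != e' -> ~~ (D e \subset D e').
  rewrite !inE => /andP[eS /eqP he] /andP[e'S /eqP he'] ne; apply/negP=> sDD.
  have : above e' \proper above e.
    rewrite properE; apply/andP; split.
      by apply/subsetP=> x; rewrite !inE => /andP[-> /(subset_trans sDD)].
    apply/subsetP=> /(_ e); rewrite !inE eS subxx /= => /(_ isT) sD'D; case/eqP: ne.
    apply: (shore_inj acyclic1); rewrite ?(subsetP sSB) //.
    by apply/eqP; rewrite eqEsubset sDD.
  by move/proper_card; rewrite he he' ltnn.
move=> e e' el e'l ne.
have sLB := subsetP (subset_trans sLS sSB).
case/or3P: (shore_laminar (sLB _ el) (sLB _ e'l)) => //.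
  by rewrite (negbTE (incomp e e' el e'l ne)).
by rewrite eq_sym in ne; rewrite (negbTE (incomp e' e e'l el ne)).
Qed.
End TwoBases.
End GraphicMatroid.

Theorem theorem5p24 (k : nat) (V E : finType) (ends : E -> V * V) :
  1 <= k -> elem_wbo ends (3 * k ^ 3) k.
Proof.
move=> k0 B1 B2 bB1 bB2 cS; apply: elem_exchange_of_large_diff => //; apply: leq_trans cS.
(* For [k >= 1], [2 * k ^ 2 <= 3 * k ^ 3]. *)
by rewrite -mul2n -mulnA mulnn leq_mul // leq_pexp2l.
Qed.
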